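(* There exists an absolute constant $C$ such that for every $1\le p<\infty$, $$\left[\frac{u(x)-u(y)}{|x-y|^{\frac{2}{p}}}\right]_{M^p(\mathbb{R}\times\mathbb{R})}\le C\,\|u'\|_{L^1(\mathbb{R})}\qquad\text{for all }u\in C_c^\infty(\mathbb{R}).$$
   Context: $C_c^\infty(\mathbb{R})$ is the space of real-valued smooth compactly supported functions on $\mathbb{R}$. For $1\le p<\infty$ and a measurable function $f$ on $\mathbb{R}\times\mathbb{R}$, the Marcinkiewicz (weak $L^p$) quasi-norm is defined by $$[f]_{M^p(\mathbb{R}\times\mathbb{R})}^p=\sup_{\lambda>0}\lambda^p\,\mathcal{L}^{2}\bigl(\{(x,y)\in\mathbb{R}\times\mathbb{R}:\ |f(x,y)|\ge\lambda\}\bigr),$$ where $\mathcal{L}^2$ is Lebesgue measure on $\mathbb{R}\times\mathbb{R}$. The quotient is regarded as a function of $(x,y)$, defined for $x\ne y$. The constant $C$ does not depend on $p$ or $u$. *)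

(* Defs.v *)
From HB Require Import structures.
From mathcomp Require Import all_boot all_order all_algebra.
From mathcomp Require Import all_classical all_reals all_analysis.
Set Implicit Arguments.
Unset Strict Implicit.
Unset Printing Implicit Defensive.
Import Order.TTheory GRing.Theory Num.Theory.
Import numFieldNormedType.Exports.
Local Open Scope classical_set_scope.
Local Open Scope ring_scope.

Definition smooth (R : realType) (u : R -> R) : Prop :=
  forall (n : nat) (x : R), derivable (u^`(n))%classic x 1.

Definition compactly_supported (R : realType) (u : R -> R) : Prop :=
  compact (closure [set x | u x != 0]).

Definition Ccinfty (R : realType) : set (R -> R) :=
  [set u | smooth u /\ compactly_supported u].
Arguments Ccinfty : clear implicits.

Definition lebesgue2 (R : realType) : set (R * R) -> \bar R :=
  ((@lebesgue_measure R) \x (@lebesgue_measure R))%E.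

Definition marcinkiewicz_norm (R : realType) (p : R) (f : R * R -> R) : \bar R :=
  (ereal_sup [set (lambda `^ p)%:E * lebesgue2 [set z | (lambda <= `|f z|)%R]
              | lambda in [set lambda : R | (0 < lambda)%R]] `^ p^-1)%E.

(* On the diagonal the value is 0 (both the difference and the inverse of
   [0 `^ s] vanish), so the diagonal lies in no set {|f| >= lambda} with
   lambda > 0: the level sets only see the points with x != y. *)
Definition diff_quotient (R : realType) (s : R) (u : R -> R) (z : R * R) : R :=
  (u z.1 - u z.2) / `|z.1 - z.2| `^ s.

(* Main.v *)
(* The exponent 1 case is a Vitali covering argument: if m |x - y|^2 <= |u x - u y|
   then the interval I with endpoints x and y satisfies m |I|^2 <= \int_I |u'|, and
   these lengths are bounded. For a disjoint subfamily I_j whose fivefold dilates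
   contain all the I, the level set is covered by the squares 5I_j x 5I_j, so
   m times its measure is at most 25 \sum_j m |I_j|^2 <= 25 \int |u'|. Larger
   exponents reduce to this one because |u x - u y| <= \int |u'|. *)
Require Import Defs.
From HB Require Import structures.
From mathcomp Require Import all_boot all_order all_algebra.
From mathcomp Require Import all_classical all_reals all_analysis.
From mathcomp Require Import measurable_realfun ring lra.
Import Order.TTheory GRing.Theory Num.Theory.
Import numFieldNormedType.Exports.
Local Open Scope classical_set_scope.
Local Open Scope ring_scope.

(* The constant is (5 * 2)^2: an interval of radius r dilated five times has length 10 r. *)
Lemma vitali_square_bound (R : realType) (f : R -> \bar R) (k M : R)
    (V : set (R * {posnum R})) (A : set (R * R)) :
  measurable_fun setT f -> (forall x, 0 <= f x)%E -> 0 <= k ->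
  (forall i, V i -> i.2%:num <= M) ->
  (forall i, V i -> ((k * i.2%:num ^+ 2)%:E <=
     \int[@lebesgue_measure R]_(x in closed_ball i.1 i.2%:num) f x)%E) ->
  measurable (A : set (measurableTypeR R * measurableTypeR R)) ->
  A `<=` \bigcup_(i in V) (closed_ball i.1 i.2%:num `*` closed_ball i.1 i.2%:num) ->
  (k%:E * lebesgue2 A <= 100%:E * \int[@lebesgue_measure R]_x f x)%E.
Proof.
move=> mf f0 k0 VM Vk mA AV.
pose B (i : R * {posnum R}) : set R := ball i.1 i.2%:num.
have radB i : (radius (B i))%:num = i.2%:num by rewrite radius_ball_num.
have bB i : is_ball (B i) by exact: is_ball_ball.
have clB i : closure (B i) = closed_ball i.1 i.2%:num by [].
have [||D [cD DV tD cov]] := @vitali_lemma_infinite R _ B V M bB.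
- by move=> i; rewrite radB.
- by move=> i /VM; rewrite radB.
have /countable_injP[e einj] := cD.
pose Q (i : R * {posnum R}) : set R := closed_ball i.1 (5 * i.2%:num).
(* The injection [e] numbers the selected balls: [G n] is the closed ball and [S n] the dilated
   square of the one [i] in [D] with [e i = n], both empty if there is none. Series over [n] then
   replace sums over [D]. *)
pose G n := \bigcup_(i in [set i | D i /\ e i = n]) closure (B i).
pose S n := \bigcup_(i in [set i | D i /\ e i = n]) (Q i `*` Q i).
have GS n : (G n = set0 /\ S n = set0) \/
    exists2 i, D i & G n = closure (B i) /\ S n = Q i `*` Q i.
  rewrite /G /S.
  have [[i [Di ein]]|h] := pselect (exists i, D i /\ e i = n).
    right; exists i => //.
    suff -> : [set i | D i /\ e i = n] = [set i] by rewrite !bigcup_set1.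
    by apply/seteqP; split => [j [Dj ejn]|j ->//]; apply: einj; rewrite ?inE// ejn.
  left; suff -> : [set i | D i /\ e i = n] = set0 by rewrite !bigcup_set0.
  by apply/seteqP; split => // i Hi; apply: h; exists i.
have mG n : measurable (G n).
  by case: (GS n) => [[-> _]//|[i _ [-> _]]]; rewrite clB; exact: measurable_closed_ball.
have mS n : measurable (S n : set (measurableTypeR R * measurableTypeR R)).
  case: (GS n) => [[_ ->]//|[i _ [_ ->]]].
  by apply: measurableX; exact: measurable_closed_ball.
have tG : trivIset setT G.
  move=> m n _ _ [x [[i [Di <-] Bix] [j [Dj <-] Bjx]]].
  by congr (e _); apply: tD Di Dj _; exists x.
have AS : A `<=` \bigcup_n S n.
  move=> z /AV[i Vi [/= z1 z2]].
  (* One [j] serves both coordinates of [z], since both lie in the same ball. *)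
  have [j [Dj _ _ ij]] := cov i Vi.
  exists (e j) => //; exists j => //.
  have : closed_ball i.1 i.2%:num `<=` Q j.
    by rewrite /Q; move: ij; rewrite clB scale_ballE.
  by move=> iQ; split; exact: iQ.
have Sle n : (k%:E * lebesgue2 (S n) <=
    100%:E * \int[@lebesgue_measure R]_(x in G n) f x)%E.
  case: (GS n) => [[-> ->]|[i Di [-> ->]]].
    by rewrite /lebesgue2 measure0 mule0 integral_set0 mule0.
  have -> : lebesgue2 (Q i `*` Q i) =
      (((5 * i.2%:num) *+ 2)%:E * ((5 * i.2%:num) *+ 2)%:E)%E.
    transitivity (lebesgue_measure (Q i) * lebesgue_measure (Q i))%E.
      by apply: product_measure1E; exact: measurable_closed_ball.
    by rewrite lebesgue_measure_closed_ball// mulr_ge0.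
  have -> : (k%:E * (((5 * i.2%:num) *+ 2)%:E * ((5 * i.2%:num) *+ 2)%:E))%E
      = (100%:E * (k * i.2%:num ^+ 2)%:E)%E.
    by rewrite -!EFinM; congr EFin; ring.
  by rewrite lee_pmul2l//; apply: Vk; exact: DV.
(* Subadditivity over the squares, then [Sle] term by term; the [G n] being disjoint, the integrals
   add up to one over their union. *)
apply: (@le_trans _ _ (k%:E * \sum_(n <oo) lebesgue2 (S n)))%E.
  by apply: lee_pmul => //; apply: measure_sigma_subadditive.
rewrite -nneseriesZl//.
apply: (@le_trans _ _ (\sum_(n <oo) (100%:E * \int[@lebesgue_measure R]_(x in G n) f x)))%E.
  by apply: lee_nneseries => // n _ _; rewrite mule_ge0.
rewrite nneseriesZl; last by move=> n _; exact: integral_ge0.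
rewrite lee_pmul2l//.
rewrite -ge0_integral_bigcup//; last exact: measurable_funTS.
by apply: ge0_subset_integral => //; exact: bigcupT_measurable.
Qed.

(** The fundamental theorem of calculus. Only the derivative between the two points enters, so
    disjoint intervals draw on disjoint parts of the total integral. *)
Lemma increment_le_integral_derive (R : realType) (u : R -> R) (x y : R) :
  (forall x, derivable u x 1) -> continuous (u^`())%classic -> x < y ->
  (`|u x - u y|%:E <=
     \int[@lebesgue_measure R]_(t in `[x, y]) `|(u^`())%classic t|%:E)%E.
Proof.
move=> du cu' xy.
have cu : continuous u.
  by move=> z; apply: differentiable_continuous; exact/derivable1_diffP.
have FTC : (\int[@lebesgue_measure R]_(t in `[x, y]) ((u^`())%classic t)%:E =
   (u y)%:E - (u x)%:E)%E.
  apply: continuous_FTC2 => //.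
  - exact: continuous_subspaceT.
  - split => //; [exact/cvg_at_right_filter/cu|exact/cvg_at_left_filter/cu].
rewrite distrC; change (`|u y - u x|%:E) with (`|(u y)%:E - (u x)%:E|)%E.
rewrite -FTC; apply: le_abse_integral => //.
apply/measurable_EFinP; apply: measurable_funTS.
exact: continuous_measurable_fun.
Qed.

Lemma increment_le_total_variation (R : realType) (u : R -> R) (x y : R) :
  (forall x, derivable u x 1) -> continuous (u^`())%classic ->
  (`|u x - u y|%:E <= \int[@lebesgue_measure R]_t `|(u^`())%classic t|%:E)%E.
Proof.
move=> du cu'.
have mu' : measurable_fun setT (fun t => `|(u^`())%classic t|%:E).
  apply/measurable_EFinP; apply: measurableT_comp => //.
  exact: continuous_measurable_fun.
wlog xy : x y / x <= y => [H|].
  by have [|/ltW] := leP x y; [exact: H|rewrite distrC; exact: H].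
have [->|xny] := eqVneq x y.
  by rewrite subrr normr0; exact: integral_ge0.
apply: le_trans (increment_le_integral_derive _ _ _ _ du cu' _) _.
  by rewrite lt_neqAle xny.
exact: ge0_subset_integral.
Qed.

(** A pair in [A] spans an interval of radius r = |x - y| / 2, so m |x - y|^2 = 4 m r^2:
    [vitali_square_bound] applies with [k] equal to 4 m, and its constant 100 divided by 4 gives
    25. *)
Lemma weak_type_quadratic (R : realType) (u : R -> R) (m : R) (A : set (R * R)) :
  (forall x, derivable u x 1) -> continuous (u^`())%classic -> 0 < m ->
  measurable (A : set (measurableTypeR R * measurableTypeR R)) ->
  (forall z, A z -> z.1 != z.2 /\ m * (z.1 - z.2) ^+ 2 <= `|u z.1 - u z.2|) ->
  (m%:E * lebesgue2 A <=
     25%:E * \int[@lebesgue_measure R]_t `|(u^`())%classic t|%:E)%E.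
Proof.
move=> du cu' m0 mA Az; set f := fun t => (`|(u^`())%classic t|%:E)%E.
have mf : measurable_fun setT f.
  apply/measurable_EFinP; apply: measurableT_comp => //.
  exact: continuous_measurable_fun.
have f0 x : (0 <= f x)%E by rewrite lee_fin.
have I0 : (0 <= \int[@lebesgue_measure R]_t f t)%E by exact: integral_ge0.
(* An infinite integral makes the bound trivial; a finite one bounds the radii of the balls in
   [W]. *)
have [foo|fin] := eqVneq (\int[@lebesgue_measure R]_t f t)%E +oo%E.
  by rewrite foo gt0_muley// leey.
have Ifin : (\int[@lebesgue_measure R]_t f t)%E \is a fin_num.
  by rewrite ge0_fin_numE// ltey.
pose W := [set i : R * {posnum R} | ((4 * m) * i.2%:num ^+ 2)%:E <=
   \int[@lebesgue_measure R]_(t in closed_ball i.1 i.2%:num) f t]%E.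
have mem_W (x y : R) : x < y -> m * (x - y) ^+ 2 <= `|u x - u y| ->
    exists2 i, W i & closed_ball i.1 i.2%:num = `[x, y]%classic.
  move=> xy mxy; have r0 : 0 < (y - x) / 2 by rewrite divr_gt0// subr_gt0.
  have xE : (x + y) / 2 - (y - x) / 2 = x by field.
  have yE : (x + y) / 2 + (y - x) / 2 = y by field.
  exists ((x + y) / 2, PosNum r0); last by rewrite closed_ball_itv//= xE yE.
  rewrite /W/= closed_ball_itv// xE yE.
  apply: le_trans (increment_le_integral_derive _ _ _ _ du cu' xy).
  rewrite lee_fin (le_trans _ mxy)//.
  by have -> : 4 * m * ((y - x) / 2) ^+ 2 = m * (x - y) ^+ 2 by field.
(* The bound on the radii combines r <= 1 + r^2 with 4 m r^2 <= \int f, which avoids a square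
   root. *)
have := @vitali_square_bound R f (4 * m)
  (1 + fine (\int[@lebesgue_measure R]_t f t)%E / (4 * m)) W A mf f0.
have m4 : 0 < 4 * m by rewrite mulr_gt0.
move=> /(_ (ltW m4)) vit.
have : ((4 * m)%:E * lebesgue2 A <= 100%:E * \int[@lebesgue_measure R]_x f x)%E.
  apply: vit => //.
  - move=> i; rewrite /W/= => Wi.
    have : 4 * m * i.2%:num ^+ 2 <= fine (\int[@lebesgue_measure R]_t f t)%E.
      rewrite -lee_fin fineK// (le_trans Wi)//.
      apply: ge0_subset_integral => //; exact: measurable_closed_ball.
    rewrite mulrC -ler_pdivlMr// => h; apply: (@le_trans _ _ (1 + i.2%:num ^+ 2)).
      by nra.
    by rewrite lerD2l.
  - move=> [x y] /Az[/= xny mxy].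
    have [xy|yx] : x < y \/ y < x by apply/orP; rewrite -neq_lt.
      have [i Wi iE] := mem_W _ _ xy mxy.
      by exists i => //; rewrite iE; split; rewrite /= in_itv/= lexx ltW.
    have [i Wi iE] : exists2 i, W i & closed_ball i.1 i.2%:num = `[y, x]%classic.
      by apply: mem_W => //; rewrite distrC -sqrrN opprB.
    by exists i => //; rewrite iE; split; rewrite /= in_itv/= lexx ltW.
have -> : 100%:E = (4%:E * 25%:E)%E :> \bar R by rewrite -EFinM; congr EFin; ring.
by rewrite EFinM -!muleA lee_pmul2l.
Qed.

Lemma measurable_diff_quotient (R : realType) (s : R) (u : R -> R) :
  continuous u ->
  measurable_fun (setT : set (measurableTypeR R * measurableTypeR R))
    (diff_quotient s u : _ -> measurableTypeR R).
Proof.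
move=> cu.
have mu := continuous_measurable_fun cu.
(* With exponent -s the denominator becomes a measurable factor; [powRN] holds at 0 too, so the
   diagonal is no exception. *)
have -> : diff_quotient s u =
    (fun z => (u z.1 - u z.2) * `|z.1 - z.2| `^ (- s)).
  by apply/funext => z; rewrite /diff_quotient powRN.
apply: measurable_funM.
  by apply: measurable_funB; apply: measurableT_comp.
apply: (measurableT_comp (measurable_powR (- s))).
apply: measurableT_comp => //; exact: measurable_funB.
Qed.

(* Since |u x - u y| <= v, the level set at height lambda for the exponent p
   lies in the level set at height lambda^p / v^(p-1) for the exponent 1. *)
Lemma level_set_quadratic (R : realType) (u : R -> R) (p v lambda : R) (z : R * R) :
  1 <= p -> 0 < lambda -> 0 < v -> `|u z.1 - u z.2| <= v ->
  lambda <= `|diff_quotient (2 / p) u z| ->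
  z.1 != z.2 /\ lambda `^ p / v `^ (p - 1) * (z.1 - z.2) ^+ 2 <= `|u z.1 - u z.2|.
Proof.
case: z => x y /= p1 l0 v0 uv; rewrite /diff_quotient/= => lq.
have p0 : 0 < p by exact: lt_le_trans p1.
have xny : x != y.
  apply: contraTneq lq => ->.
  by rewrite !subrr mul0r normr0 -ltNge.
split => //.
have w0 : 0 < `|x - y| by rewrite normr_gt0 subr_eq0.
move: lq; rewrite normrM normfV (ger0_norm (powR_ge0 _ _)).
rewrite ler_pdivlMr ?powR_gt0// => lq.
(* Raising to the power p turns |x - y|^(2/p) into |x - y|^2. *)
have lqp : (lambda * `|x - y| `^ (2 / p)) `^ p <= `|u x - u y| `^ p.
  apply: ge0_ler_powR => //; rewrite ?nnegrE ?mulr_ge0 ?powR_ge0 ?ltW//.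
rewrite powRM ?powR_ge0 ?(ltW l0)// in lqp.
rewrite -powRrM divfK ?gt_eqF// powR_mulrn// real_normK ?num_real// in lqp.
rewrite mulrAC ler_pdivrMr ?powR_gt0//; apply: le_trans lqp _.
(* One factor |u x - u y| is split off the p-th power; the remaining power p - 1 >= 0 is at most
   v^(p-1). *)
rewrite -mulr_powRB1// ler_wpM2l//.
by apply: ge0_ler_powR; rewrite ?nnegrE ?subr_ge0// ltW.
Qed.

Theorem theorem3 (R : realType) :
  exists C : R, forall p : R, 1 <= p ->
    forall u : R -> R, Ccinfty R u ->
      (marcinkiewicz_norm p (diff_quotient (2 / p) u)
         <= C%:E * 'N[@lebesgue_measure R]_1 [EFin \o (u^`())%classic])%E.
Proof.
exists 25 => p p1 u [su _].
have p0 : 0 < p by exact: lt_le_trans p1.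
have du x : derivable u x 1 by exact: (su 0%N).
have cu : continuous u.
  by move=> z; apply: differentiable_continuous; exact/derivable1_diffP.
have cu' : continuous (u^`())%classic.
  by move=> z; apply: differentiable_continuous; apply/derivable1_diffP; exact: (su 1%N).
rewrite Lnorm1.
change (\int[@lebesgue_measure R]_x `|(EFin \o (u^`())%classic) x|)%E
  with (\int[@lebesgue_measure R]_x (`|(u^`())%classic x|%:E))%E.
have I0 : (0 <= \int[@lebesgue_measure R]_x (`|(u^`())%classic x|%:E))%E.
  exact: integral_ge0.
have [->|fin] := eqVneq (\int[@lebesgue_measure R]_x (`|(u^`())%classic x|%:E))%E +oo%E.
  by rewrite gt0_muley// leey.
have [v v0 vE] : exists2 v : R, 0 <= v &
    (\int[@lebesgue_measure R]_x (`|(u^`())%classic x|%:E))%E = v%:E.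
  exists (fine (\int[@lebesgue_measure R]_x (`|(u^`())%classic x|%:E))%E).
    exact: fine_ge0.
  by rewrite fineK// ge0_fin_numE// ltey.
rewrite vE.
have uv x y : `|u x - u y| <= v.
  by rewrite -lee_fin -vE; exact: increment_le_total_variation.
have level (lambda : R) : 0 < lambda -> ((lambda `^ p)%:E *
    lebesgue2 [set z | (lambda <= `|diff_quotient (2 / p) u z|)%R] <= (25 * v `^ p)%:E)%E.
  (* If [v] is 0, then [u] is constant and the level set is empty. This case is set apart because
     [m] divides by v^(p-1). *)
  move=> l0; move: v0; rewrite le_eqVlt => /predU1P[v0|v0].
    rewrite (_ : [set z | _] = set0).
      by rewrite /lebesgue2 measure0 mule0 lee_fin mulr_ge0// powR_ge0.
    apply/seteqP; split => // -[x y]; rewrite /= /diff_quotient/=.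
    have -> : u x - u y = 0.
      by apply/eqP; rewrite -normr_le0 v0.
    by rewrite mul0r normr0 leNgt l0.
  set A := [set z | _]; pose m := lambda `^ p / v `^ (p - 1).
  have mA : measurable (A : set (measurableTypeR R * measurableTypeR R)).
    have mq := measurableT_comp (@normr_measurable R setT)
      (measurable_diff_quotient R (2 / p) u cu).
    have := mq measurableT _ (measurable_itv `[lambda, +oo[).
    rewrite setTI; congr measurable; apply/seteqP.
    by split => z; rewrite /A/= in_itv/= andbT.
  have m0 : 0 < m by rewrite divr_gt0 ?powR_gt0.
  have Az z : A z -> z.1 != z.2 /\ m * (z.1 - z.2) ^+ 2 <= `|u z.1 - u z.2|.
    by move=> Az; exact: level_set_quadratic.
  have := @weak_type_quadratic R u m A du cu' m0 mA Az.
  have w0 : 0 < v `^ (p - 1) by exact: powR_gt0.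
  (* Multiplying by v^(p-1) turns [m] back into lambda^p, and v into v^p. *)
  rewrite vE -(@lee_pmul2l _ (v `^ (p - 1))%:E)// muleA -!EFinM.
  rewrite mulrC divfK ?gt_eqF// => /le_trans; apply.
  by rewrite lee_fin mulrCA (mulrC _ v) mulr_powRB1// ltW.
rewrite /marcinkiewicz_norm; set S := (X in ereal_sup X).
(* The power 1/p is monotone on nonnegative values; the term at lambda = 1 shows that the supremum
   is one. *)
have S0 : (0 <= ereal_sup S)%E.
  apply: le_trans (ereal_sup_ubound _); last by exists 1; [exact: ltr01|].
  by rewrite mule_ge0// lee_fin powR_ge0.
have S25 : (ereal_sup S <= (25 * v `^ p)%:E)%E.
  by apply: ge_ereal_sup => _ [lambda l0 <-]; exact: level.
apply: (@le_trans _ _ ((25 * v `^ p)%:E `^ p^-1)%E).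
  apply: gt0_ler_poweR => //; first by rewrite invr_ge0 ltW.
  - by rewrite in_itv/= S0 leey.
  - by rewrite in_itv/= (le_trans S0)// leey.
(* The p-th root of 25 v^p is 25^(1/p) v, and 25^(1/p) <= 25 since p >= 1: hence a constant uniform
   in p. *)
rewrite poweR_EFin -EFinM lee_fin powRM ?powR_ge0//.
rewrite -powRrM mulfV ?gt_eqF// powRr1// ler_wpM2r//.
by apply: ler1_powR; [lra|rewrite invf_le1].
Qed.
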